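(* A graph $G$ is a half-square of a star convex bipartite graph (i.e., there is a star convex bipartite graph $B=(V(G),W,E_B)$ with $G=B^2[V(G)]$) if and only if (i) $G$ has at most one big connected component and the big connected component (if any) has a universal vertex, or (ii) $G$ is obtained from a split graph by substituting vertices by cliques.
   Context: For a bipartite graph $B=(X,Y,E_B)$, the half-square $B^2[X]$ is the graph on $X$ where two distinct vertices are adjacent iff they have a common neighbor in $Y$. $B$ is tree $X$-convex if there is a tree $T$ on vertex set $X$ such that for each $y\in Y$, the neighborhood $N(y)$ induces a subtree of $T$; tree $Y$-convex is defined symmetrically. $B$ is star convex if it is tree $X$-convex or tree $Y$-convex with the tree $T$ being a star. A connected component is big if it has at least two vertices; a universal vertex of a (connected) graph is adjacent to all other vertices of it. A split graph is a graph whose vertex set can be partitioned into a clique and a stable set. Substituting a vertex $v$ of a graph $G$ by a graph $H$ (vertex-disjoint from $G$) yields the graph obtained from $G-v$ and $H$ by adding all edges between $N_G(v)$ and $V(H)$; ''substituting vertices by cliques'' means substituting some vertices, each by a (nonempty) complete graph. *)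

(* Defs.v *)
From HB Require Import structures.
From mathcomp Require Import all_boot.

Set Implicit Arguments.
Unset Strict Implicit.
Unset Printing Implicit Defensive.

(* Finite simple graphs with vertex set (the whole type) V. *)
Record graph (V : finType) := Graph {
  adj :> rel V;
  adj_sym : symmetric adj;
  adj_irr : irreflexive adj
}.

Definition isomorphic (V W : finType) (G : graph V) (H : graph W) : Prop :=
  exists2 f : V -> W, bijective f & forall x y, G x y = H (f x) (f y).

Section Induced.
Variables (V : finType) (G : graph V) (S : {set V}).

Definition induced_rel : rel {x : V | x \in S} := fun x y => G (val x) (val y).

Lemma induced_sym : symmetric induced_rel.
Proof. by move=> x y; apply: adj_sym. Qed.

Lemma induced_irr : irreflexive induced_rel.
Proof. by move=> x; apply: adj_irr. Qed.

Definition induced : graph {x : V | x \in S} := Graph induced_sym induced_irr.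
End Induced.

Section Notions.
Variables (V : finType) (G : graph V).

Definition connected : Prop := forall x y : V, connect G x y.

(* [ucycle] also accepts the empty sequence and, by symmetry of G, [:: x; y]
   for an edge xy; graph cycles are those of length at least 3. *)
Definition acyclic : Prop := forall c : seq V, ucycle G c -> size c <= 2.

Definition is_tree : Prop := [/\ 0 < #|V|, connected & acyclic].

Definition universal (u : V) : Prop := forall v : V, v != u -> G u v.

Definition is_star : Prop := is_tree /\ exists c : V, universal c.

Definition complete : Prop := forall x y : V, x != y -> G x y.

Definition clique (K : {set V}) : Prop :=
  forall x y : V, x \in K -> y \in K -> x != y -> G x y.

Definition stable (S : {set V}) : Prop :=
  forall x y : V, x \in S -> y \in S -> ~~ G x y.

Definition is_split : Prop :=
  exists K S : {set V},
    [/\ K :|: S = setT, K :&: S = set0, clique K & stable S].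

Definition components : {set {set V}} := equivalence_partition (connect G) setT.

Definition big_components : {set {set V}} := [set C in components | 2 <= #|C|].

End Notions.

(* The empty set counts as an (empty) subtree, so that isolated vertices of a
   bipartite graph put no constraint on its convexity. *)
Definition induces_subtree (X : finType) (T : graph X) (S : {set X}) : Prop :=
  S = set0 \/ is_tree (induced T S).

Section Bipartite.
(* B x y: the vertex x of the side X is adjacent to the vertex y of the side Y *)
Variables (X Y : finType) (B : X -> Y -> bool).

Definition nbrsY (x : X) : {set Y} := [set y | B x y].
Definition nbrsX (y : Y) : {set X} := [set x | B x y].

Definition half_square_rel : rel X :=
  fun x x' => (x != x') && [exists y, B x y && B x' y].

Lemma half_square_sym : symmetric half_square_rel.
Proof.
move=> x x'; rewrite /half_square_rel eq_sym; congr (_ && _).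
by apply: eq_existsb => y; rewrite andbC.
Qed.

Lemma half_square_irr : irreflexive half_square_rel.
Proof. by move=> x; rewrite /half_square_rel eqxx. Qed.

Definition half_square : graph X := Graph half_square_sym half_square_irr.

Definition star_X_convex : Prop :=
  exists T : graph X, is_star T /\ forall y, induces_subtree T (nbrsX y).

Definition star_Y_convex : Prop :=
  exists T : graph Y, is_star T /\ forall x, induces_subtree T (nbrsY x).

Definition star_convex : Prop := star_X_convex \/ star_Y_convex.
End Bipartite.

(* Simultaneous substitution of every vertex v of D by a graph F v: the
   vertices are those of H outside D together with the disjoint union of the
   vertex sets of the graphs F v. *)
Section Substitution.
Variables (U : finType) (H : graph U) (D : {set U}).
Variables (P : {v : U | v \in D} -> finType) (F : forall v, graph (P v)).

Definition subst_vertex : finType :=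
  ({x : U | x \notin D} + {v : {v : U | v \in D} & P v})%type.

(* the vertex of H that p is, or that the graph containing p replaces *)
Definition subst_origin (p : subst_vertex) : U :=
  match p with inl x => val x | inr a => val (tag a) end.

(* By irreflexivity of H, the first disjunct only relates vertices of distinct
   origins; the second gives the edges inside a copy F v. *)
Definition subst_rel : rel subst_vertex := fun p q =>
  H (subst_origin p) (subst_origin q) ||
  match p, q with
  | inr a, inr b => (tag a == tag b) && F (tag a) (tagged a) (tagged_as a b)
  | _, _ => false
  end.

Lemma subst_sym : symmetric subst_rel.
Proof.
move=> p q; rewrite /subst_rel adj_sym; congr (_ || _).
case: p q => [x|[u a]] [y|[v b]] //=.
case: (eqVneq u v) => [e|//] /=; move: b; rewrite -e => b.
by rewrite !tagged_asE adj_sym.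
Qed.

Lemma subst_irr : irreflexive subst_rel.
Proof.
move=> p; rewrite /subst_rel adj_irr /=.
by case: p => [x|[u a]] //=; rewrite tagged_asE adj_irr andbF.
Qed.

Definition substitution : graph subst_vertex := Graph subst_sym subst_irr.
End Substitution.

Definition clique_substitution_of (U : finType) (H : graph U)
    (V : finType) (G : graph V) : Prop :=
  exists (D : {set U}) (P : {v : U | v \in D} -> finType)
         (F : forall v, graph (P v)),
    (forall v, 0 < #|P v| /\ complete (F v)) /\
    isomorphic G (substitution H F).

(* Main.v *)
Require Import Defs.
From mathcomp Require Import all_boot.

(** If the star is on [X], every nonempty neighbourhood is a singleton or
    contains the centre [c], so every vertex on an edge of the half-square is
    [c] or adjacent to [c]: this is (i). If the star is on [Y], the vertices
    adjacent to the centre form a clique, and each other vertex has at most one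
    neighbour, so that these fall into classes of true twins; contracting the
    classes yields a split graph: this is (ii).

    Conversely, for (i) take a vertex of [Y] with neighbourhood [{x, y, u}] for
    each edge [xy], where [u] is the universal vertex. For (ii), with [r] mapping
    each vertex to its origin in a split graph with clique [K] and stable set
    [S], let [Y] consist of a centre joined to the vertices with origin in [K],
    and of one vertex [s] for each [s] in [S], joined to the vertices whose
    origin is [s] or adjacent to [s]. *)

Set Implicit Arguments.
Unset Strict Implicit.
Unset Printing Implicit Defensive.

(** * Stars described by their edges, and their subtrees *)

Section Stars.
Variables (V : finType) (G : graph V).

(** Together with [universal], this describes stars by their edges, so that cycles need not be
    handled later. *)
Definition centered (c : V) : Prop := forall x y, G x y -> (x == c) || (y == c).

(** An edge avoiding [c] would form a triangle with [c]. *)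
Lemma tree_universal_centered c : is_tree G -> universal G c -> centered c.
Proof.
case=> _ _ acG univ x y Gxy; apply/negPn/negP; rewrite negb_or => /andP[xc yc].
have xy : x != y by apply/eqP=> e; rewrite e adj_irr in Gxy.
suff /acG : ucycle G [:: c; x; y] by [].
rewrite /ucycle /= univ // Gxy adj_sym univ //= !inE negb_or.
by rewrite eq_sym xc eq_sym yc xy.
Qed.

Lemma centered_universal_tree c : universal G c -> centered c -> is_tree G.
Proof.
move=> univ cen; split; first by apply/card_gt0P; exists c.
- have cc x : connect G c x.
    by case: (eqVneq x c) => [->|/univ/connect1].
  have symG : connect_sym G by apply: sym_connect_sym; exact: adj_sym.
  by move=> x y; apply: (connect_trans (y := c)); first rewrite symG.
- move=> [|x [|y [|z s]]] //; case/andP=> /= /and3P[Gxy Gyz pz].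
  rewrite !inE !negb_or => /andP[/and3P[xy xz _] /andP[/andP[yz ys] _]].
  (* If [y] is the centre, the next edge of the cycle out of [z], back to [x] or on to some [t],
     avoids it. Otherwise [x] and [z] are both the centre. *)
  have [e|yc] := eqVneq y c.
    subst y; case: s ys pz => [|t s] /=.
      by move=> _; rewrite andbT => /cen; rewrite (negPf xy) eq_sym (negPf yz).
    rewrite inE negb_or => /andP[ct _] /andP[/cen].
    by rewrite eq_sym (negPf yz) eq_sym (negPf ct).
  have := cen _ _ Gxy; have := cen _ _ Gyz; rewrite (negPf yc) orbF /=.
  by move=> /eqP zc /eqP xc; rewrite xc zc eqxx in xz.
Qed.

End Stars.

(** The first edge of a path from [x] to [y] inside [S] contains the centre. *)
Lemma star_subtree_center (X : finType) (T : graph X) (c : X) (S : {set X}) x y :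
  is_tree T -> universal T c -> induces_subtree T S ->
  x \in S -> y \in S -> x != y -> c \in S.
Proof.
move=> treeT univ [->|[_ conS _]]; first by rewrite inE.
move=> xS yS xy; case/connectP: (conS (exist _ x xS) (exist _ y yS)).
case=> [|z p] /=; first by move=> _ /(congr1 val) /= e; rewrite e eqxx in xy.
case/andP=> /(tree_universal_centered treeT univ) /orP[] /eqP /= e _ _.
  by rewrite -e.
by rewrite -e (valP z).
Qed.

(** * The star with a given centre *)

Section StarGraph.
Variables (X : finType) (c : X).

Definition star_rel : rel X := fun x y => (x == c) (+) (y == c).

Lemma star_rel_sym : symmetric star_rel.
Proof. by move=> x y; rewrite /star_rel addbC. Qed.

Lemma star_rel_irr : irreflexive star_rel.
Proof. by move=> x; rewrite /star_rel addbb. Qed.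

Definition star_graph : graph X := Graph star_rel_sym star_rel_irr.

Lemma star_graph_universal : universal star_graph c.
Proof. by move=> v vc; rewrite /= /star_rel eqxx (negPf vc). Qed.

Lemma star_graph_centered : centered star_graph c.
Proof. by move=> x y; rewrite /= /star_rel; case: (x == c). Qed.

Lemma star_graph_star : is_star star_graph.
Proof.
split; last by exists c; apply: star_graph_universal.
apply: (@centered_universal_tree _ _ c).
  exact: star_graph_universal.
exact: star_graph_centered.
Qed.

(** The only vertex serves as the centre, whether or not it is [c]. *)
Lemma star_graph_subtree1 (x : X) : induces_subtree star_graph [set x].
Proof.
right; pose o : {y | y \in [set x]} := exist _ x (set11 x).
have all_o y : y = o by apply: val_inj; apply/set1P; exact: (valP y).
apply: (@centered_universal_tree _ _ o) => [v|v w _]; last by rewrite (all_o v) eqxx.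
by rewrite (all_o v) eqxx.
Qed.

Lemma star_graph_subtree (S : {set X}) : c \in S -> induces_subtree star_graph S.
Proof.
move=> cS; right; apply: (@centered_universal_tree _ _ (exist _ c cS)) => [v|v w].
  by move=> vc; apply: star_graph_universal.
exact: star_graph_centered.
Qed.

End StarGraph.

(** * Big components and condition (i) *)

Section BigComponents.
Variables (V : finType) (G : graph V).

Lemma connect_neighbor x y : connect G x y -> x != y -> exists z, G x z.
Proof.
case/connectP=> [[|z p]] /=; first by move=> _ ->; rewrite eqxx.
by case/andP=> Gxz _ _ _; exists z.
Qed.

Lemma big_componentsP (C : {set V}) :
  reflect (exists2 x, C = [set y | connect G x y] & exists y, G x y)
          (C \in big_components G).
Proof.
have compE x : [set y in [set: V] | connect G x y] = [set y | connect G x y].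
  by apply/setP=> y; rewrite !inE.
rewrite inE; apply: (iffP andP) => [[/imsetP[x _ ->]]|[x -> [y Gxy]]].
  rewrite compE => /card_gt1P[a [b [aC bC ab]]]; exists x => //.
  (* One of the distinct vertices [a], [b] differs from [x], and a path from [x] to it begins with
     an edge. *)
  have [e|xa] := eqVneq x a.
    by rewrite -e inE in ab bC; apply: connect_neighbor bC ab.
  by rewrite inE in aC; apply: connect_neighbor aC xa.
split; first by apply/imsetP; exists x; rewrite ?compE.
apply/card_gt1P; exists x, y; split; rewrite ?inE ?connect0 ?connect1 //.
by apply/eqP=> e; rewrite e adj_irr in Gxy.
Qed.

Definition one_big_component_universal : Prop :=
  #|big_components G| <= 1 /\
  forall C : {set V}, C \in big_components G ->
    exists u, universal (induced G C) u.

(** Since [G] is symmetric, this bears on both ends of every edge: each non-isolated vertex is [u]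
    or a neighbour of [u]. *)
Definition dominated (u : V) : Prop := forall x y, G x y -> (x == u) || G u x.

(** Restates (i) without components. The edgeless case stands apart because a graph without vertices
    offers no [u]. *)
Lemma one_big_component_universalP :
  one_big_component_universal <->
  (forall x y, ~~ G x y) \/ exists u, dominated u.
Proof.
have symG : connect_sym G by apply: sym_connect_sym; exact: adj_sym.
split=> [[/card_le1_eqP le1 univ]|].
  have [/existsP[x /existsP[y Gxy]]|/existsPn noE] :=
    boolP [exists x, exists y, G x y]; last first.
    by left=> x y; apply: contra (noE x) => Gxy; apply/existsP; exists y.
  right; have big z t : G z t -> [set w | connect G z w] \in big_components G.
    by move=> Gzt; apply/big_componentsP; exists z => //; exists t.
  have [[u uC] uP] := univ _ (big _ _ Gxy); exists u => z t Gzt.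
  have zC : z \in [set w | connect G x w].
    by rewrite (le1 _ _ (big _ _ Gzt) (big _ _ Gxy)) inE connect0.
  by have [//|zu] := eqVneq z u; apply: (uP (exist _ z zC)).
case=> [noE|[u dom]].
  have noC C : C \notin big_components G.
    by apply/big_componentsP=> [[x _ [y]]]; apply/negP.
  split=> [|C]; last by rewrite (negPf (noC C)).
  by apply/card_le1_eqP=> C D; rewrite (negPf (noC C)).
(* A big component contains a vertex with a neighbour, which is [u] or adjacent to [u]; so it is the
   component of [u]. *)
have compE C : C \in big_components G -> C = [set y | connect G u y].
  case/big_componentsP=> x -> [y /dom].
  have [-> //|_ /= /connect1 Gux] := eqVneq x u.
  by apply/setP=> z; rewrite !inE (same_connect symG Gux).
split; first by apply/card_le1_eqP=> C D /compE -> /compE ->.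
move=> C /compE ->; have uC : u \in [set y | connect G u y] by rewrite inE.
exists (exist _ u uC) => -[v vC] vu /=; rewrite /induced_rel /=.
have {}vu : v != u by apply: contraNneq vu => e; apply/eqP/val_inj.
rewrite inE symG in vC; have [z /dom] := connect_neighbor vC vu.
by rewrite (negPf vu).
Qed.

End BigComponents.

(** * Clique substitutions as maps to origins *)

Section CliqueSubstitution.
Variables (V U : finType) (G : graph V) (H : graph U).

(** The fibres of [r] are the substituted cliques. Some may be empty, as [r] need not be
    surjective. *)
Definition blow_up_map (r : V -> U) : Prop :=
  forall x y, G x y = H (r x) (r y) || (x != y) && (r x == r y).

Lemma clique_substitution_blow_up :
  clique_substitution_of H G -> exists r, blow_up_map r.
Proof.
case=> D [P [F [FP [f [g fK gK] fP]]]]; exists (fun x => subst_origin (f x)).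
move=> x y; rewrite fP /= /subst_rel; congr (_ || _).
have -> : (x != y) = (f x != f y) by rewrite (can_eq fK).
case: (f x) (f y) => [[a aD]|[[a aD] p]] [[b bD]|[[b bD] q]] /=.
(* A kept vertex and a replaced one have distinct origins, since only the latter's lies in [D]; this
   settles the two mixed cases. *)
- by rewrite (inj_eq (@inl_inj _ _)) -val_eqE /= andNb.
- by have [e|] := eqVneq a b; rewrite ?andbF //; rewrite e bD in aD.
- by have [e|] := eqVneq a b; rewrite ?andbF //; rewrite -e aD in bD.
rewrite -val_eqE /=; have [e|] := eqVneq a b; last by rewrite andbF.
subst b; have e := bool_irrelevance aD bD; subst bD.
rewrite tagged_asE andbT (inj_eq (@inr_inj _ _)) -tag_eqE /tag_eq /= eqxx tagged_asE /=.
have [_ comp] := FP (exist _ a aD).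
by have [->|/comp ->] := eqVneq p q; rewrite ?adj_irr.
Qed.

Definition complete_rel (T : finType) : rel T := fun x y => x != y.

Lemma complete_rel_sym (T : finType) : symmetric (@complete_rel T).
Proof. by move=> x y; rewrite /complete_rel eq_sym. Qed.

Lemma complete_rel_irr (T : finType) : irreflexive (@complete_rel T).
Proof. by move=> x; rewrite /complete_rel eqxx. Qed.

Definition complete_graph (T : finType) : graph T :=
  Graph (@complete_rel_sym T) (@complete_rel_irr T).

(** Every vertex of [H] is replaced by its fibre, made a complete graph; surjectivity makes the
    fibres nonempty. *)
Lemma blow_up_clique_substitution (r : V -> U) :
  (forall u, exists x, r x = u) -> blow_up_map r -> clique_substitution_of H G.
Proof.
move=> surj rP.
pose P (v : {v : U | v \in [set: U]}) : finType := {x : V | r x == val v}.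
exists setT, P, (fun v => complete_graph (P v)); split.
  move=> v; split=> //; have [x rx] := surj (val v).
  by apply/card_gt0P; exists (exist _ x (introT eqP rx)).
pose f x : subst_vertex P :=
  inr (Tagged P (exist _ x (eqxx (r x)) : P (exist _ (r x) (in_setT (r x))))).
pose g (p : subst_vertex P) : V := match p with
  | inl x => match negP (valP x) (in_setT (val x)) with end
  | inr a => val (tagged a)
  end.
have gK : cancel g f.
  case=> [[u nu]|[[u uT] [x rx]]]; first by exfalso; rewrite inE in nu.
  rewrite /f /=; move: rx => /= rx; have e := eqP rx; subst u.
  have e := bool_irrelevance uT (in_setT (r x)); subst uT.
  by have e := bool_irrelevance rx (eqxx (r x)); subst rx.
have fK : cancel f g by [].
exists f; first by exists g.
move=> x y; rewrite rP /= /subst_rel /=; congr (_ || _).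
rewrite -val_eqE /= andbC; have [e|//] := eqVneq (r x) (r y).
rewrite /= /complete_rel -(can_eq fK) /f (inj_eq (@inr_inj _ _)).
rewrite -tag_eqE /tag_eq /= (_ : (exist _ _ _ == _ :> {v | v \in _}) = true) //.
by apply/eqP/val_inj.
Qed.

End CliqueSubstitution.

Lemma induced_split (U : finType) (H : graph U) (A : {set U}) :
  is_split H -> is_split (induced H A).
Proof.
case=> K [S [KS dKS clK stS]].
exists [set x | val x \in K], [set x | val x \in S]; split.
- by apply/setP=> x; move/setP/(_ (val x)): KS; rewrite !inE.
- by apply/setP=> x; move/setP/(_ (val x)): dKS; rewrite !inE.
- by move=> x y; rewrite !inE => xK yK xy; apply: clK.
- by move=> x y; rewrite !inE => xS yS; apply: stS.
Qed.

(** Restricting [H] to the image of [r] makes [r] surjective and keeps the graph split. *)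
Lemma split_blow_up_substitution (V U : finType) (G : graph V) (H : graph U) r :
  is_split H -> blow_up_map G H r ->
  exists (U' : finType) (H' : graph U'), is_split H' /\ clique_substitution_of H' G.
Proof.
move=> splitH rP; pose A := [set r x | x in V].
exists {u | u \in A}, (induced H A); split; first exact: induced_split.
have rA x : r x \in A by apply: imset_f.
apply: (@blow_up_clique_substitution _ _ _ _ (fun x => exist _ (r x) (rA x))).
  case=> u uA; have /imsetP[x _ e] := uA.
  by exists x; apply: val_inj; rewrite /= e.
by move=> x y; rewrite rP -val_eqE.
Qed.

(** * From star convexity to domination or a blow-up of a split graph *)

Section HalfSquare.
Variables (V : finType) (G : graph V).

Lemma star_X_half_square_dominated (W : finType) (B : V -> W -> bool) :
  star_X_convex B -> (forall x y, G x y = half_square B x y) ->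
  exists u, dominated G u.
Proof.
case=> T [[treeT [c univ]] subT] GB; exists c => x y; rewrite GB => /andP[xy].
case/existsP=> w /andP[Bx By]; have [//|xc] := eqVneq x c.
have := star_subtree_center treeT univ (subT w) _ _ xy.
rewrite !inE => /(_ Bx By) Bc; rewrite GB /= /half_square_rel eq_sym xc.
by apply/existsP; exists w; rewrite Bc.
Qed.

Lemma star_Y_half_square_blow_up (W : finType) (B : V -> W -> bool) :
  star_Y_convex B -> (forall x y, G x y = half_square B x y) ->
  exists (U : finType) (H : graph U) (r : V -> U), is_split H /\ blow_up_map G H r.
Proof.
case=> T [[treeT [c univ]] subT] GB.
have uniqN x w w' : ~~ B x c -> B x w -> B x w' -> w = w'.
  move=> nxc Bw Bw'; apply/eqP; apply: contraNT nxc => ww.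
  by have := star_subtree_center treeT univ (subT x) _ _ ww; rewrite !inE; apply.
(* The split graph: the [inl x] with [B x c] form the clique, and [inr w] stands for the class of
   vertices whose only neighbour is [w]. Every other [inl x] is isolated. *)
pose h (p q : V + W) := match p, q with
  | inl x, inl y => [&& x != y, B x c & B y c]
  | inl x, inr w | inr w, inl x => B x c && B x w
  | inr _, inr _ => false
  end.
have h_sym : symmetric h.
  by move=> [x|w] [y|w'] //=; rewrite eq_sym [B x c && _]andbC.
have h_irr : irreflexive h by move=> [x|w] //=; rewrite eqxx.
pose K : {set V + W} := [set p | if p is inl x then B x c else false].
(* A vertex not adjacent to the centre represents its only neighbour, if any. *)
pose r x : V + W :=
  if B x c then inl x else if [pick w | B x w] is Some w then inr w else inl x.
exists (V + W)%type, (Graph h_sym h_irr), r; split.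
  exists K, (~: K); split; rewrite ?setUCr ?setICr //.
  - move=> [x|w] [y|w']; rewrite !inE //= => -> -> xy.
    by rewrite !andbT; apply: contraNneq xy => ->.
  - by move=> [x|w] [y|w']; rewrite !inE //=; case: (B _ c); rewrite ?andbF.
move=> x y; rewrite GB /= /half_square_rel /r.
have [->|xy] /= := eqVneq x y; first by rewrite h_irr.
have inlE : ((inl x : V + W) == inl y) = false.
  by rewrite (inj_eq (@inl_inj _ _)) (negPf xy).
apply/existsP/idP => [[w /andP[Bx By]]|].
  (* For a vertex not adjacent to [c], the common neighbour [w] is its only neighbour, hence the one
     picked by [r]. *)
  have [xc|nxc] := boolP (B x c); have [yc|nyc] := boolP (B y c).
  - by rewrite /= xy xc yc.
  - case: pickP => [w' Bw'|/(_ w)]; last by rewrite By.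
    by rewrite /= xc -(uniqN _ _ _ nyc By Bw') Bx.
  - case: pickP => [w' Bw'|/(_ w)]; last by rewrite Bx.
    by rewrite /= yc -(uniqN _ _ _ nxc Bx Bw') By.
  - case: pickP => [w1 Bw1|/(_ w)]; last by rewrite Bx.
    case: pickP => [w2 Bw2|/(_ w)]; last by rewrite By.
    by rewrite -(uniqN _ _ _ nxc Bx Bw1) -(uniqN _ _ _ nyc By Bw2) eqxx orbT.
(* A vertex without neighbours is sent to its own isolated [inl], which by [inlE] is not the image
   of the other vertex. *)
have [xc|nxc] := boolP (B x c); have [yc|nyc] := boolP (B y c).
- by exists c; rewrite xc yc.
- case: pickP => [w Bw|_]; rewrite ?inlE orbF /= xc ?(negPf nyc) ?andbF //.
  by exists w; rewrite Bw andbT.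
- case: pickP => [w Bw|_]; rewrite ?inlE orbF /= yc ?(negPf nxc) ?andbF //.
  by exists w; rewrite Bw.
- case: pickP => [w1 Bw1|_]; case: pickP => [w2 Bw2|_];
    rewrite ?inlE /= ?(negPf nxc) ?(negPf nyc) ?andbF //=.
  by rewrite (inj_eq (@inr_inj _ _)) => /eqP e; exists w1; rewrite Bw1 e.
Qed.

(** * Constructing star convex bipartite graphs *)

Lemma edgeless_half_square :
  (forall x y, ~~ G x y) ->
  exists (W : finType) (B : V -> W -> bool),
    star_convex B /\ forall x y, G x y = half_square B x y.
Proof.
move=> noE; exists unit, (fun _ _ => false); split; last first.
  move=> x y; rewrite (negPf (noE x y)) /= /half_square_rel.
  by apply/esym/negbTE; rewrite negb_and; apply/orP; right; apply/existsP => -[].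
(* The star is put on [unit], as [V] may be empty and a star has a centre. *)
right; exists (star_graph tt); split; first exact: star_graph_star.
by move=> x; left; apply/setP=> y; rewrite !inE.
Qed.

Lemma dominated_half_square (u : V) :
  dominated G u ->
  exists (W : finType) (B : V -> W -> bool),
    star_convex B /\ forall x y, G x y = half_square B x y.
Proof.
(* All ordered pairs serve as [Y]; those that are not edges get an empty neighbourhood. *)
move=> dom; pose B z (e : V * V) := G e.1 e.2 && (z \in [:: e.1; e.2; u]).
exists (V * V)%type, B; split.
  left; exists (star_graph u); split=> [|[x y]]; first exact: star_graph_star.
  have [Gxy|nGxy] := boolP (G x y).
    by apply: star_graph_subtree; rewrite !inE /B Gxy !inE eqxx !orbT.
  by left; apply/setP=> z; rewrite !inE /B (negPf nGxy).
move=> x y; apply/idP/andP => [Gxy|[xy /existsP[[a b] /andP[]]]].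
  split; first by apply/eqP=> e; rewrite e adj_irr in Gxy.
  by apply/existsP; exists (x, y); rewrite /B Gxy !inE !eqxx orbT.
rewrite /B /= => /andP[Gab xab] /andP[_ yab].
have Gba : G b a by rewrite adj_sym.
have domab z : z \in [:: a; b; u] -> (z == u) || G u z.
  by rewrite !inE => /or3P[]/eqP->; rewrite ?eqxx ?(dom _ _ Gab) ?(dom _ _ Gba).
(* If [x] or [y] is [u], [domab] makes the other adjacent to it; otherwise they are the two ends of
   the edge [a b]. *)
have [xu|xu] := eqVneq x u.
  by have := domab y yab; rewrite xu eq_sym -xu (negPf xy).
have [yu|yu] := eqVneq y u.
  by have := domab x xab; rewrite yu -yu (negPf xy) adj_sym.
move: xab yab; rewrite !inE (negPf xu) (negPf yu) !orbF.
by do 2![case/orP=> /eqP ?]; subst; rewrite ?eqxx // in xy *.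
Qed.

Lemma split_blow_up_half_square (U : finType) (H : graph U) (r : V -> U) :
  is_split H -> blow_up_map G H r ->
  exists (W : finType) (B : V -> W -> bool),
    star_convex B /\ forall x y, G x y = half_square B x y.
Proof.
case=> K [S [KS dKS clK stS]] rP.
have SE u : (u \in S) = (u \notin K).
  move/setP/(_ u): KS; move/setP/(_ u): dKS; rewrite !inE.
  by case: (u \in K); case: (u \in S).
pose B x (w : option U) := if w is Some s
  then (s \in S) && ((r x == s) || H (r x) s) else r x \in K.
exists (option U), B; split.
  right; exists (star_graph None); split=> [|x]; first exact: star_graph_star.
  (* With origin in [K], the neighbourhood contains the centre [None]; with origin in [S], stability
     reduces it to a singleton. *)
  have [xK|nxK] := boolP (r x \in K).
    by apply: star_graph_subtree; rewrite inE.
  suff -> : nbrsY B x = [set Some (r x)] by apply: star_graph_subtree1.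
  apply/setP=> -[s|]; rewrite !inE /= ?(negPf nxK) //.
  rewrite (inj_eq Some_inj) eq_sym; have [->|_] := eqVneq s (r x).
    by rewrite SE nxK.
  by apply/andP=> -[sS]; apply/negP/stS; rewrite // SE.
move=> x y; rewrite rP /= /half_square_rel.
have [->|xy] /= := eqVneq x y; first by rewrite adj_irr.
have NS z s : r z \in S -> B z (Some s) -> r z = s.
  by move=> zS /= /andP[sS /orP[/eqP//|]]; rewrite (negPf (stS _ _ zS sS)).
(* If both origins are in [K], the centre is a common neighbour. Otherwise [NS] leaves only the
   origin lying in [S] as a possible one. *)
have [xK|nxK] := boolP (r x \in K); have [yK|nyK] := boolP (r y \in K).
- rewrite (_ : [exists w, _]); last by apply/existsP; exists None; rewrite /= xK.
  by have [//|ne] := eqVneq (r x) (r y); rewrite ?orbT ?clK.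
- have ne : (r x == r y) = false by apply/eqP=> e; rewrite -e xK in nyK.
  have yS : r y \in S by rewrite SE.
  rewrite ne orbF; apply/idP/existsP => [Hxy|[[s|] /andP[Bx By]]].
  + by exists (Some (r y)); rewrite /= yS Hxy eqxx orbT.
  + by move: Bx; rewrite -(NS _ _ yS By) /= ne => /andP[].
  + by rewrite /= (negPf nyK) in By.
- have ne : (r y == r x) = false by apply/eqP=> e; rewrite -e yK in nxK.
  have xS : r x \in S by rewrite SE.
  rewrite eq_sym ne orbF adj_sym; apply/idP/existsP => [Hxy|[[s|] /andP[Bx By]]].
  + by exists (Some (r x)); rewrite /= xS Hxy eqxx orbT.
  + by move: By; rewrite -(NS _ _ xS Bx) /= ne => /andP[].
  + by rewrite /= (negPf nxK) in Bx.
- have xS : r x \in S by rewrite SE.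
  have yS : r y \in S by rewrite SE.
  rewrite (negPf (stS _ _ xS yS)) /=.
  apply/eqP/existsP => [e|[[s|] /andP[Bx By]]].
  + by exists (Some (r x)); rewrite /= e yS eqxx.
  + by rewrite (NS _ _ xS Bx) (NS _ _ yS By).
  + by rewrite /= (negPf nxK) in Bx.
Qed.

End HalfSquare.

Theorem theorem2 (V : finType) (G : graph V) :
  (exists (W : finType) (B : V -> W -> bool),
      star_convex B /\ forall x y : V, G x y = half_square B x y)
  <->
  ((#|big_components G| <= 1 /\
    forall C : {set V}, C \in big_components G ->
      exists u, universal (induced G C) u)
   \/
   (exists (U : finType) (H : graph U),
      is_split H /\ clique_substitution_of H G)).
Proof.
split=> [[W [B [[convB|convB] GB]]]|[/one_big_component_universalP[noE|[u dom]]|]].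
- left; apply/one_big_component_universalP; right.
  exact: star_X_half_square_dominated convB GB.
- right; have [U [H [r [splitH rP]]]] := star_Y_half_square_blow_up convB GB.
  exact: split_blow_up_substitution splitH rP.
- exact: edgeless_half_square.
- exact: dominated_half_square dom.
- case=> U [H [splitH /clique_substitution_blow_up[r rP]]].
  exact: split_blow_up_half_square splitH rP.
Qed.
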